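(* Let $(M,d)$ be a countable proper pointed metric space with origin $0$ and let $$S=\left\{ f\in lip_0(M)\ ;\ \lim_{r\rightarrow +\infty}\ \sup_{\substack{x \text{ or } y \notin \overline{B}(0,r)\\ x\neq y}}\frac{f(x)-f(y)}{d(x,y)}=0 \right\},$$ normed by the Lipschitz constant. Then $\mathcal{F}(M)$ is isometrically isomorphic to $S^*$.
   Context: All spaces are real. A metric space is proper if every closed ball is compact. A pointed metric space $(M,d)$ is a metric space with a distinguished point (origin) $0\in M$. $\overline{B}(x,r)=\{y\in M: d(x,y)\le r\}$ is the closed ball. $Lip_0(M)$ is the Banach space of Lipschitz functions $f:M\to\mathbb{R}$ with $f(0)=0$, normed by the Lipschitz constant $\|f\|_L$. $lip_0(M)$ is the subspace of those $f\in Lip_0(M)$ such that for every $\varepsilon>0$ there is $\delta>0$ such that $d(x,y)<\delta$ implies $|f(x)-f(y)|\le\varepsilon d(x,y)$. For $x\in M$, $\delta_x\in Lip_0(M)^*$ is given by $\delta_x(f)=f(x)$; the Lipschitz-free space $\mathcal{F}(M)$ is the norm-closed linear span of $\{\delta_x: x\in M\}$ in $Lip_0(M)^*$. In the definition of $S$, the supremum is over pairs $(x,y)\in M^2$ with $x\ne y$ and at least one of $x,y$ outside $\overline{B}(0,r)$; the supremum over an empty set of pairs is taken to be $0$ (so $S=lip_0(M)$ if $M$ is bounded). *)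

(* Defs.v *)
From HB Require Import structures.
From mathcomp Require Import all_boot all_order all_algebra.
From mathcomp Require Import all_classical all_reals all_analysis.

Set Implicit Arguments.
Unset Strict Implicit.
Unset Printing Implicit Defensive.

Import Order.TTheory GRing.Theory Num.Theory.
Import numFieldNormedType.Exports.

Local Open Scope classical_set_scope.
Local Open Scope ring_scope.

Section normed_subspace.
Context {R : realType} {V : normedModType R}.

Record normed_subspace (A : submodClosed V) := NormedSubspace {
  subspace_val :> V ;
  _ : subspace_val \in A }.

HB.instance Definition _ (A : submodClosed V) :=
  [isSub for @subspace_val A].
HB.instance Definition _ (A : submodClosed V) :=
  [Choice of normed_subspace A by <:].
HB.instance Definition _ (A : submodClosed V) :=
  [SubChoice_isSubLmodule of normed_subspace A by <:].

Definition subspace_norm (A : submodClosed V) (u : normed_subspace A) : R :=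
  `|subspace_val u|.

Lemma subspace_normD (A : submodClosed V) (u v : normed_subspace A) :
  subspace_norm (u + v) <= subspace_norm u + subspace_norm v.
Proof. exact: ler_normD. Qed.

Lemma subspace_normZ (A : submodClosed V) (a : R) (u : normed_subspace A) :
  subspace_norm (a *: u) = `|a| * subspace_norm u.
Proof. exact: normrZ. Qed.

Lemma subspace_norm0_eq0 (A : submodClosed V) (u : normed_subspace A) :
  subspace_norm u = 0 -> u = 0.
Proof. by move=> /normr0_eq0 u0; apply: val_inj. Qed.

HB.instance Definition _ (A : submodClosed V) :=
  Lmodule_isNormed.Build R (normed_subspace A)
    (@subspace_normD A) (@subspace_normZ A) (@subspace_norm0_eq0 A).

Definition lin_span (A : set V) : set V :=
  [set v | exists (n : nat) (a : 'I_n -> R) (x : 'I_n -> V),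
     (forall i, A (x i)) /\ v = \sum_(i < n) a i *: x i].

Definition closed_span (A : set V) : {pred V} := mem (closure (lin_span A)).

Lemma lin_span_lin (A : set V) (a : R) (u v : V) :
  lin_span A u -> lin_span A v -> lin_span A (a *: u + v).
Proof.
move=> [m [b [x [Ax ->]]]] [n [c [y [Ay ->]]]].
exists (m + n)%N.
exists (fun i => match fintype.split i with inl j => a * b j | inr j => c j end).
exists (fun i => match fintype.split i with inl j => x j | inr j => y j end).
split=> [i|]; first by case: fintype.split.
rewrite big_split_ord/= scaler_sumr; congr (_ + _); apply: eq_bigr => i _.
  by rewrite -/(unsplit (inl i)) unsplitK scalerA.
by rewrite -/(unsplit (inr i)) unsplitK.
Qed.

Lemma closed_span_submod_closed (A : set V) : submod_closed (closed_span A).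
Proof.
split=> [|a u v].
  rewrite inE; apply: subset_closure.
  exists 0%N, (fun=> 0), (fun=> 0); split=> [[]//|]; by rewrite big_ord0.
rewrite !inE => clu clv B.
move=> /nbhs_ballP[e /= e0 eB].
have d0 : 0 < e / 2 / (`|a| + 1) by rewrite !divr_gt0// ltr_wpDl.
have e20 : 0 < e / 2 by rewrite divr_gt0.
have [u' [su' uu']] := clu _ (nbhsx_ballx u _ d0).
have [v' [sv' vv']] := clv _ (nbhsx_ballx v _ e20).
exists (a *: u' + v'); split; first exact: lin_span_lin.
apply: eB; move: uu' vv'; rewrite -!ball_normE /ball_/= => uu' vv'.
rewrite opprD addrACA -scalerBr (le_lt_trans (ler_normD _ _))//.
rewrite [e]splitr ler_ltD// normrZ.
rewrite (@le_trans _ _ ((`|a| + 1) * (e / 2 / (`|a| + 1))))//.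
  by rewrite ler_pM// ?lerDl// ltW.
by rewrite mulrC divfK// gt_eqF// ltr_wpDl.
Qed.

HB.instance Definition _ (A : set V) :=
  GRing.isSubmodClosed.Build R V (closed_span A) (closed_span_submod_closed A).

End normed_subspace.

Section dual.
Context {R : realType} (V : normedModType R).

Definition dual_pred : {pred (V -> R)} :=
  mem [set phi : V -> R | linear (phi : V -> R^o) /\ continuous phi].

Lemma dual_submod_closed : submod_closed dual_pred.
Proof.
split=> [|a phi psi]; rewrite !inE/=.
  split=> [b x y|]; first by rewrite scaler0 addr0.
  exact: cst_continuous.
move=> [lphi cphi] [lpsi cpsi]; split=> [b x y|x].
  rewrite !fctE lphi lpsi !scalerDr !scalerA mulrC.
  by rewrite -!addrA; congr (_ + _); rewrite addrCA.
by apply: cvgD; [apply: cvgZr; exact: cphi|exact: cpsi].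
Qed.

HB.instance Definition _ :=
  GRing.isSubmodClosed.Build R (V -> R) dual_pred dual_submod_closed.

Record dual := Dual { dual_val :> V -> R ; _ : dual_val \in dual_pred }.

HB.instance Definition _ := [isSub for dual_val].
HB.instance Definition _ := [Choice of dual by <:].
HB.instance Definition _ := [SubChoice_isSubLmodule of dual by <:].

Lemma dual_linear (phi : dual) : linear (phi : V -> R^o).
Proof. by have := valP phi; rewrite inE => -[]. Qed.

Lemma dual_continuous (phi : dual) : continuous phi.
Proof. by have := valP phi; rewrite inE => -[]. Qed.

HB.instance Definition _ (phi : dual) :=
  GRing.isLinear.Build R V R^o *:%R (dual_val phi : V -> R^o)
    (@dual_linear phi).

Definition op_norm (phi : dual) : R :=
  sup [set `|phi x| | x in [set x : V | `|x| <= 1]].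

Lemma op_norm_has_sup (phi : dual) :
  has_sup [set `|phi x| | x in [set x : V | `|x| <= 1]].
Proof.
split; first by exists `|phi 0|, 0 => //=; rewrite normr0.
have /linear_bounded_continuous/bounded_funP/(_ 1)[k phik] :
  continuous (dual_val phi : V -> R^o) := @dual_continuous phi.
by exists k => _ [x /= x1 <-]; exact: phik.
Qed.

Lemma op_norm_ge0 (phi : dual) : 0 <= op_norm phi.
Proof.
apply: (@le_trans _ _ `|phi 0|) => //; apply: ub_le_sup.
  exact: (op_norm_has_sup phi).2.
by exists 0 => //=; rewrite normr0.
Qed.

Lemma op_norm_le (phi : dual) (x : V) : `|phi x| <= op_norm phi * `|x|.
Proof.
have [->|x0] := eqVneq x 0.
  by rewrite (linear0 (dual_val phi : {linear V -> R^o})) !normr0 mulr0.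
have nx0 : 0 < `|x| by rewrite normr_gt0.
rewrite -ler_pdivrMr//.
rewrite (_ : _ / _ = `|phi (`|x|^-1 *: x)|); last first.
  rewrite (linearZ_LR (dual_val phi : {linear V -> R^o})) normrM.
  by rewrite normfV normr_id mulrC.
apply: ub_le_sup; first exact: (op_norm_has_sup phi).2.
by exists (`|x|^-1 *: x) => //=; rewrite normrZ normfV normr_id mulVf// gt_eqF.
Qed.

Lemma op_norm_lub (phi : dual) (k : R) : 0 <= k ->
  (forall x, `|phi x| <= k * `|x|) -> op_norm phi <= k.
Proof.
move=> k0 phik; apply: ge_sup; first exact: (op_norm_has_sup phi).1.
by move=> _ [x /= x1 <-]; rewrite (le_trans (phik x))// ler_piMr.
Qed.

Lemma op_normD (phi psi : dual) :
  op_norm (phi + psi) <= op_norm phi + op_norm psi.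
Proof.
apply: op_norm_lub => [|x]; first by rewrite addr_ge0// op_norm_ge0.
rewrite mulrDl (le_trans (ler_normD _ _))//.
by rewrite lerD// op_norm_le.
Qed.

Lemma op_normZ (a : R) (phi : dual) : op_norm (a *: phi) = `|a| * op_norm phi.
Proof.
have le b psi : op_norm (b *: psi) <= `|b| * op_norm psi.
  apply: op_norm_lub => [|x]; first by rewrite mulr_ge0// op_norm_ge0.
  rewrite [X in `|X|](_ : _ = b * psi x)// normrM -mulrA.
  by rewrite ler_wpM2l// op_norm_le.
apply/eqP; rewrite eq_le le/=; have [->|a0] := eqVneq a 0.
  by rewrite normr0 mul0r op_norm_ge0.
rewrite -ler_pdivlMl ?normr_gt0// -normfV.
by rewrite -[in leLHS](scalerK a0 phi) le.
Qed.

Lemma op_norm0_eq0 (phi : dual) : op_norm phi = 0 -> phi = 0.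
Proof.
move=> phi0; apply/val_inj/funext => x; apply/eqP.
by rewrite -normr_le0 (le_trans (op_norm_le _ _))// phi0 mul0r.
Qed.

HB.instance Definition _ :=
  Lmodule_isNormed.Build R dual op_normD op_normZ op_norm0_eq0.

End dual.

Section metric.
Context {R : realType} {M : metricType R}.

(* The library's [closed_ball x r] is the closure of the open ball, which may
   be strictly smaller. *)
Definition mdist_closed_ball (x : M) (r : R) : set M :=
  [set y | mdist x y <= r].

Definition proper_metric := forall (x : M) (r : R),
  compact (mdist_closed_ball x r).

End metric.
Arguments proper_metric {R} M.

Section Lip0.
Context {R : realType} {M : metricType R} (o : M).

Definition Lip0_pred : {pred (M -> R)} :=
  mem [set f : M -> R | f o = 0 /\
    exists k : R, forall x y, `|f x - f y| <= k * mdist x y].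

Lemma Lip0_submod_closed : submod_closed Lip0_pred.
Proof.
split=> [|a f g]; rewrite !inE/=.
  by split=> //; exists 0 => x y; rewrite subrr normr0 mul0r.
move=> [f0 [k fk]] [g0 [l gl]]; split; first by rewrite !fctE f0 g0 scaler0 addr0.
exists (`|a| * k + l) => x y.
rewrite !fctE opprD addrACA -scalerBr mulrDl (le_trans (ler_normD _ _))//.
by rewrite lerD// normrM -mulrA ler_wpM2l.
Qed.

HB.instance Definition _ :=
  GRing.isSubmodClosed.Build R (M -> R) Lip0_pred Lip0_submod_closed.

Record Lip0 := MkLip0 { Lip0_val :> M -> R ; _ : Lip0_val \in Lip0_pred }.

HB.instance Definition _ := [isSub for Lip0_val].
HB.instance Definition _ := [Choice of Lip0 by <:].
HB.instance Definition _ := [SubChoice_isSubLmodule of Lip0 by <:].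

Lemma Lip0_base (f : Lip0) : f o = 0.
Proof. by have := valP f; rewrite inE => -[]. Qed.

Lemma Lip0_lipschitz (f : Lip0) :
  exists k : R, forall x y, `|f x - f y| <= k * mdist x y.
Proof. by have := valP f; rewrite inE => -[]. Qed.

(* On a one-point space the set is empty and its [sup] is 0. *)
Definition lip_const (f : Lip0) : R :=
  sup [set `|f p.1 - f p.2| / mdist p.1 p.2 | p in [set p : M * M | p.1 <> p.2]].

Lemma lip_const_le (f : Lip0) x y : `|f x - f y| <= lip_const f * mdist x y.
Proof.
have [->|xy] := eqVneq x y; first by rewrite subrr normr0 mdistxx mulr0.
rewrite -ler_pdivrMr ?mdist_gt0//; apply: ub_le_sup; last first.
  by exists (x, y) => //=; exact/eqP.
have [k fk] := Lip0_lipschitz f.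
exists k => _ [[u v] /= /eqP uv <-].
by rewrite ler_pdivrMr ?mdist_gt0.
Qed.

Lemma lip_const_lub (f : Lip0) (k : R) : 0 <= k ->
  (forall x y, `|f x - f y| <= k * mdist x y) -> lip_const f <= k.
Proof.
move=> k0 fk; rewrite /lip_const; set A := (X in sup X).
have [->|/set0P A0] := eqVneq A set0; first by rewrite sup0.
apply: ge_sup => // _ [[u v] /= /eqP uv <-].
by rewrite ler_pdivrMr ?mdist_gt0.
Qed.

Lemma lip_const_ge0 (f : Lip0) : 0 <= lip_const f.
Proof.
have [[x xo]|no] := pselect (exists x : M, x <> o).
  rewrite -(@pmulr_lge0 _ (mdist x o)) ?mdist_gt0//; last exact/eqP.
  exact: (le_trans _ (lip_const_le f x o)).
rewrite /lip_const [X in sup X](_ : _ = set0) ?sup0//.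
rewrite -subset0 => _ [[x y] /= xy _]; apply: no.
by have [xo|/eqP] := eqVneq x o; [exists y => yo; apply: xy; rewrite xo|exists x].
Qed.

Lemma lip_constD (f g : Lip0) : lip_const (f + g) <= lip_const f + lip_const g.
Proof.
apply: lip_const_lub => [|x y]; first by rewrite addr_ge0// lip_const_ge0.
rewrite [X in `|X|](_ : _ = (f x - f y) + (g x - g y)); last first.
  by rewrite addrACA -opprD.
by rewrite (le_trans (ler_normD _ _))// mulrDl lerD// lip_const_le.
Qed.

Lemma lip_constZ (a : R) (f : Lip0) : lip_const (a *: f) = `|a| * lip_const f.
Proof.
have le b g : lip_const (b *: g) <= `|b| * lip_const g.
  apply: lip_const_lub => [|x y]; first by rewrite mulr_ge0// lip_const_ge0.
  rewrite [X in `|X|](_ : _ = b * (g x - g y)); last by rewrite mulrBr.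
  rewrite normrM -mulrA.
  by rewrite ler_wpM2l// lip_const_le.
apply/eqP; rewrite eq_le le/=; have [->|a0] := eqVneq a 0.
  by rewrite normr0 mul0r lip_const_ge0.
rewrite -ler_pdivlMl ?normr_gt0// -normfV.
by rewrite -[in leLHS](scalerK a0 f) le.
Qed.

Lemma lip_const0_eq0 (f : Lip0) : lip_const f = 0 -> f = 0.
Proof.
move=> f0; apply/val_inj/funext => x; apply/eqP.
by have := lip_const_le f x o; rewrite f0 mul0r Lip0_base subr0 normr_le0.
Qed.

HB.instance Definition _ :=
  Lmodule_isNormed.Build R Lip0 lip_constD lip_constZ lip_const0_eq0.

Definition little_lip0 : set Lip0 :=
  [set f | forall e : R, 0 < e -> exists2 d : R, 0 < d &
     forall x y, mdist x y < d -> `|f x - f y| <= e * mdist x y].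

(* The quotients are bounded by the Lipschitz constant of [f]; when no pair
   qualifies, [sup] of the empty set is 0. *)
Definition tail_slope (f : Lip0) (r : R) : R :=
  sup [set (f p.1 - f p.2) / mdist p.1 p.2 | p in [set p : M * M |
    p.1 <> p.2 /\
    (~ mdist_closed_ball o r p.1 \/ ~ mdist_closed_ball o r p.2)]].

Definition S_pred : {pred Lip0} :=
  mem [set f | little_lip0 f /\ tail_slope f r @[r --> +oo] --> 0].

Lemma tail_slope_le (f : Lip0) (r : R) x y :
  ~ mdist_closed_ball o r x \/ ~ mdist_closed_ball o r y ->
  `|f x - f y| <= tail_slope f r * mdist x y.
Proof.
have ub u v : ~ mdist_closed_ball o r u \/ ~ mdist_closed_ball o r v ->
    u != v -> (f u - f v) <= tail_slope f r * mdist u v.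
  move=> uvr uv; rewrite -ler_pdivrMr ?mdist_gt0//; apply: ub_le_sup; last first.
    by exists (u, v) => //=; split=> //; exact/eqP.
  exists (lip_const f) => _ [[s t] /= [/eqP st _] <-].
  by rewrite ler_pdivrMr ?mdist_gt0// (le_trans (ler_norm _))// lip_const_le.
have [->|xy] := eqVneq x y; first by rewrite subrr normr0 mdistxx mulr0.
move=> xyr; rewrite ler_norml ub// andbT lerNl opprB metric_sym ub//.
  by case: xyr; [right|left].
by rewrite eq_sym.
Qed.

Lemma tail_slope_ge0 (f : Lip0) (r : R) : 0 <= tail_slope f r.
Proof.
have [[[x y] /= [xy xyr]]|no] := pselect (exists p : M * M, p.1 <> p.2 /\
    (~ mdist_closed_ball o r p.1 \/ ~ mdist_closed_ball o r p.2)).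
  rewrite -(@pmulr_lge0 _ (mdist x y)) ?mdist_gt0//; last exact/eqP.
  exact: (le_trans _ (tail_slope_le f xyr)).
rewrite /tail_slope [X in sup X](_ : _ = set0) ?sup0//.
by rewrite -subset0 => s [p /= pP _]; apply: no; exists p.
Qed.

Lemma tail_slope_lub (f : Lip0) (r k : R) : 0 <= k ->
  (forall x y, ~ mdist_closed_ball o r x \/ ~ mdist_closed_ball o r y ->
     `|f x - f y| <= k * mdist x y) -> tail_slope f r <= k.
Proof.
move=> k0 fk; rewrite /tail_slope; set A := (X in sup X).
have [->|/set0P A0] := eqVneq A set0; first by rewrite sup0.
apply: ge_sup => // _ [[u v] /= [/eqP uv uvr] <-].
by rewrite ler_pdivrMr ?mdist_gt0// (le_trans (ler_norm _))// fk.
Qed.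

Lemma S_submod_closed : submod_closed S_pred.
Proof.
split=> [|a f g]; rewrite !inE/=.
  split=> [e e0|].
    by exists 1 => // x y _; rewrite subrr normr0 mulr_ge0// ?mdist_ge0 ?ltW.
  rewrite (_ : tail_slope 0 = cst 0); first exact: cvg_cst.
  apply/funext => r; apply/eqP; rewrite eq_le tail_slope_ge0 andbT.
  by apply: tail_slope_lub => // x y _; rewrite subrr normr0 mul0r.
move=> [lf tf] [lg tg].
have afg x y : `|(a *: f + g) x - (a *: f + g) y| <=
    `|a| * `|f x - f y| + `|g x - g y|.
  rewrite -normrM (le_trans _ (ler_normD _ _))//.
  by rewrite mulrBr addrACA -opprD.
split=> [e e0|].
  have e20 : 0 < e / 2 by rewrite divr_gt0.
  have d0 : 0 < e / 2 / (`|a| + 1) by rewrite divr_gt0// ltr_wpDl.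
  have [d1 d10 fd] := lf _ d0; have [d2 d20 gd] := lg _ e20.
  exists (Num.min d1 d2); first by rewrite lt_min d10.
  move=> x y; rewrite lt_min => /andP[/fd fxy /gd gxy].
  rewrite (le_trans (afg x y))// [e in leRHS]splitr mulrDl lerD//.
  rewrite (@le_trans _ _ ((`|a| + 1) * `|f x - f y|))//.
    by rewrite ler_wpM2r// lerDl.
  by rewrite -ler_pdivlMl ?ltr_wpDl// mulrA [_^-1 * _]mulrC.
apply: (@squeeze_cvgr _ _ _ _ (cst 0)
    (fun r => `|a| * tail_slope f r + tail_slope g r)).
- apply: nearW => r; rewrite tail_slope_ge0/=.
  apply: tail_slope_lub => [|x y xyr].
    by rewrite addr_ge0 ?mulr_ge0 ?tail_slope_ge0.
  rewrite (le_trans (afg x y))// mulrDl -mulrA lerD ?ler_wpM2l//.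
  - exact: tail_slope_le.
  - exact: tail_slope_le.
- exact: cvg_cst.
- rewrite -[0](_ : `|a| * 0 + 0 = 0); last by rewrite mulr0 addr0.
  by apply: cvgD => //; apply: cvgMr.
Qed.

HB.instance Definition _ :=
  GRing.isSubmodClosed.Build R Lip0 S_pred S_submod_closed.

Definition S_space : normedModType R := normed_subspace S_pred.

Definition delta_fun (x : M) : Lip0 -> R := fun f => f x.

Lemma delta_fun_dual (x : M) : delta_fun x \in @dual_pred R Lip0.
Proof.
have lx : linear (delta_fun x : Lip0 -> R^o) by [].
rewrite inE; split=> //=.
pose L : {linear Lip0 -> R^o} :=
  HB.pack (delta_fun x : Lip0 -> R^o) (GRing.isLinear.Build _ _ _ _ _ lx).
suff: continuous L by [].
apply/linear_bounded_continuous/bounded_funP => r.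
exists (r * mdist x o) => f fr.
rewrite /= /delta_fun -[X in `|X|]subr0 -(Lip0_base f).
by rewrite (le_trans (lip_const_le _ _ _))// ler_wpM2r// mdist_ge0.
Qed.

Definition delta (x : M) : dual Lip0 := Dual (delta_fun_dual x).

Definition free_space : normedModType R :=
  normed_subspace (closed_span (range delta)).

End Lip0.

Definition isometrically_isomorphic {R : realType} (U V : normedModType R) :=
  exists2 T : {linear U -> V}, bijective T & forall u, `|T u| = `|u|.

(* Main.v *)
Require Import Defs.
From HB Require Import structures.
From mathcomp Require Import all_boot all_order all_algebra.
From mathcomp Require Import all_classical all_reals all_analysis.
From mathcomp Require Import ring lra.

(** Restricting functionals from [Lip0] to S gives a linear map of norm at most
    one from the free space to the dual of S. It is an isometry onto, for two
    reasons that both rest on the countability of M.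

    Isometric. A real function on M has countable range, which intervals of small
    total length cover. Composing a Lipschitz function with a monotone short map
    of the line that collapses such intervals makes it locally constant and moves
    it very little; truncating it first between plus and minus a cone makes its support
    bounded. So functions in the unit ball of [Lip0] are approximated, uniformly on
    balls, by functions in the unit ball of S ([S_approximation]), and elements of
    the free space, which are nearly finite combinations of evaluations, do not
    lose norm under restriction ([restr_norm]).

    Onto. To [f] in S attach its slope [(f x - f y) / d(x, y)] on the square of M,
    extended by zero on the diagonal. It is continuous by the little Lipschitz
    condition and vanishes at infinity because closed balls are compact and slopes
    decay. Since the slope is antisymmetric, the norm of [f] is its supremum and
    not only the supremum of its absolute value; so by the theorem of Hahn and
    Banach a functional on S extends to a positive functional on the bounded
    functions on the square of M ([hahn_banach], [dual_S_positive]). As M is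
    countable, a positive functional acts on continuous functions vanishing at
    infinity through its atoms, and finitely many atoms approximate it in norm
    ([finite_atomic_approx]). An atom at [(x, y)] is a multiple of the restriction
    of [delta x - delta y]. Hence the range is dense ([restr_dense]); it is closed
    since the free space is complete ([restr_surj]). *)

Set Implicit Arguments.
Unset Strict Implicit.
Unset Printing Implicit Defensive.

Import Order.TTheory GRing.Theory Num.Theory.
Import numFieldNormedType.Exports.

Local Open Scope classical_set_scope.
Local Open Scope ring_scope.

(** * Extension of dominated functionals *)

Section hahn_banach.
Context {R : realType} {V : lmodType R} (p : V -> R).
Hypothesis pD : forall u v, p (u + v) <= p u + p v.
Hypothesis pZ : forall (t : R) u, 0 <= t -> p (t *: u) = t * p u.

Let linear_graph (G : set (V * R)) := forall (t : R) u a v b,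
  G (u, a) -> G (v, b) -> G (t *: u + v, t * a + b).

Let dominated_graph (G : set (V * R)) := forall u a, G (u, a) -> a <= p u.

Let p0 : p 0 = 0.
Proof. by rewrite -(scale0r 0) pZ// mul0r. Qed.

Let graph_zero (G : set (V * R)) u a :
  linear_graph G -> G (u, a) -> G (0, 0).
Proof.
by move=> lG Gu; have := lG (-1) _ _ _ _ Gu Gu; rewrite scaleN1r mulN1r !addNr.
Qed.

Let graph_functional (G : set (V * R)) u a b :
  linear_graph G -> dominated_graph G -> G (u, a) -> G (u, b) -> a = b.
Proof.
move=> lG dG Ga Gb; apply/eqP; rewrite eq_le.
have := lG (-1) _ _ _ _ Ga Gb; have := lG (-1) _ _ _ _ Gb Ga.
rewrite scaleN1r addNr !mulN1r => /dG; rewrite p0 => ? /dG; rewrite p0 => ?.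
by apply/andP; split; lra.
Qed.

(** The value [c] at a new vector [v] has to lie above all [a - p (u - v)] and
    below all [p (u + v) - a]; subadditivity of [p] separates these two families,
    and homogeneity carries the bound from [v] to its multiples. *)
Let one_step (G : set (V * R)) v : linear_graph G -> dominated_graph G ->
  G !=set0 -> exists c : R, forall u a t, G (u, a) -> a + t * c <= p (u + t *: v).
Proof.
move=> lG dG [[u0 a0] Gu0].
have key u a u' a' : G (u, a) -> G (u', a') -> a - p (u - v) <= p (u' + v) - a'.
  move=> Gu Gu'; have := dG _ _ (lG 1 _ _ _ _ Gu Gu').
  have := pD (u - v) (u' + v); rewrite addrACA addNr addr0 scale1r mul1r; lra.
pose A := [set q.2 - p (q.1 - v) | q in G].
have supA : has_sup A.
  split; first by exists (a0 - p (u0 - v)), (u0, a0).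
  by exists (p (u0 + v) - a0) => _ [[u a] /= Gu <-]; exact: key.
exists (sup A) => u a t Gu.
have G0 := graph_zero lG Gu.
have Gs s : G (s *: u, s * a) by have := lG s _ _ _ _ Gu G0; rewrite !addr0.
have hi u' a' : G (u', a') -> sup A <= p (u' + v) - a'.
  move=> Gu'; apply: ge_sup; first exact: supA.1.
  by move=> _ [[w b] /= Gw <-]; exact: key.
have lo u' a' : G (u', a') -> a' - p (u' - v) <= sup A.
  by move=> Gu'; apply: ub_le_sup; [exact: supA.2|exists (u', a')].
have [t0|t0|->] := ltgtP t 0; last by rewrite mul0r scale0r !addr0; exact: dG.
- have nt : 0 < - t by lra.
  have := lo _ _ (Gs (- t)^-1).
  rewrite (_ : u + t *: v = (- t) *: ((- t)^-1 *: u - v)); last first.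
    by rewrite scalerBr scalerA divff ?scale1r ?gt_eqF// scaleNr opprK.
  move/(ler_wpM2l (ltW nt)); rewrite pZ; last exact: ltW.
  rewrite mulrBr mulrA divff ?gt_eqF// mul1r; lra.
- have := hi _ _ (Gs t^-1).
  rewrite (_ : u + t *: v = t *: (t^-1 *: u + v)); last first.
    by rewrite scalerDr scalerA divff ?scale1r ?gt_eqF.
  move/(ler_wpM2l (ltW t0)); rewrite pZ; last exact: ltW.
  rewrite mulrBr mulrA divff ?gt_eqF// mul1r; lra.
Qed.

(** The subspace from which one extends is presented as the image of [j], so
    that the functional can be given on [E]; domination makes it vanish on the
    kernel of [j]. Zorn's lemma is applied to graphs of dominated functionals. *)
Lemma hahn_banach (E : lmodType R) (j : {linear E -> V})
    (phi : {linear E -> R^o}) : (forall e, phi e <= p (j e)) ->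
  exists2 L : {linear V -> R^o}, (forall v, L v <= p v) &
    forall e, L (j e) = phi e.
Proof.
move=> phip.
pose G0 : set (V * R) := [set (j e, phi e) | e in setT].
have lG0 : linear_graph G0.
  move=> t _ _ _ _ [e _ [<- <-]] [e' _ [<- <-]].
  by exists (t *: e + e') => //; rewrite !linearP.
have dG0 : dominated_graph G0 by move=> _ _ [e _ [<- <-]].
(* The last clause is an implication so that the empty graph, which is the
   union of the empty chain, qualifies. *)
pose P (G : set (V * R)) :=
  [/\ linear_graph G, dominated_graph G & G !=set0 -> G0 `<=` G].
have [F FP Ftot|G [[lG dG G0G] Gmax]] := @Zorn_bigcup _ P.
  split.
  - move=> t u a v b [G FG Gu] [G' FG' Gv].
    have [GG'|G'G] := Ftot _ _ FG FG'.
      by exists G' => //; have [lG _ _] := FP _ FG'; apply: lG => //; exact: GG'.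
    by exists G => //; have [lG _ _] := FP _ FG; apply: lG => //; exact: G'G.
  - by move=> u a [G FG Gu]; have [_ dG _] := FP _ FG; exact: dG.
  - move=> [q [G FG Gq]] z G0z; exists G => //.
    by have [_ _ h] := FP _ FG; apply: h => //; exists q.
have Gn0 : G !=set0.
  apply: contrapT => /set0P/negP/negPn/eqP GE.
  have PG0 : P G0.
    split; first exact: lG0.
    exact: dG0.
    by move=> _ q.
  apply: (Gmax G0) => //.
  by rewrite GE; split => // /(_ (j 0, phi 0)); apply; exists 0.
have total v : exists a, G (v, a).
  apply: contrapT => nv.
  have [c cP] := one_step v lG dG Gn0.
  have [[u0 a0] Gu0] := Gn0.
  have G00 := graph_zero lG Gu0.
  pose G' : set (V * R) :=
    [set (q.1.1 + q.2 *: v, q.1.2 + q.2 * c) | q in [set q | G q.1]].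
  have GG' : G `<=` G'.
    by move=> [u a] Gu; exists ((u, a), 0) => //=; rewrite scale0r mul0r !addr0.
  apply: (Gmax G').
    split => // /(_ (v, c)) Gv; apply: nv; exists c; apply: Gv.
    by exists ((0, 0), 1) => //=; rewrite scale1r mul1r !add0r.
  split.
  - move=> t _ _ _ _ [[[u a] s] /= Gu [<- <-]] [[[u' a'] s'] /= Gu' [<- <-]].
    exists ((t *: u + u', t * a + a'), t * s + s') => /=; first exact: lG.
    congr (_, _); last by ring.
    by rewrite scalerDr scalerDl scalerA addrACA.
  - by move=> _ _ [[[u a] s] /= Gu [<- <-]]; exact: cP.
  - by move=> _; apply: subset_trans GG'; exact: G0G.
have [l lP] := choice total.
have llin : linear (l : V -> R^o).
  move=> t u v; apply: (graph_functional lG dG (lP _)).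
  exact: lG.
pose L : {linear V -> R^o} :=
  HB.pack (l : V -> R^o) (GRing.isLinear.Build _ _ _ _ _ llin).
exists L => [v|e] /=; first exact: dG.
by apply: (graph_functional lG dG (lP _)); apply: G0G => //; exists e.
Qed.

End hahn_banach.

(** * Bounded functions *)

Section bounded_functions.
Context {R : realType} {X : Type}.

Definition bfun_pred : {pred (X -> R)} :=
  mem [set f : X -> R | exists C : R, forall x, `|f x| <= C].

Lemma bfun_submod_closed : submod_closed bfun_pred.
Proof.
split=> [|a f g]; rewrite !inE/=.
  by exists 0 => x; rewrite normr0.
move=> [C fC] [D gD]; exists (`|a| * C + D) => x.
rewrite !fctE (le_trans (ler_normD _ _))// lerD// normrM.
by rewrite ler_wpM2l.
Qed.

HB.instance Definition _ :=
  GRing.isSubmodClosed.Build R (X -> R) bfun_pred bfun_submod_closed.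

Record bfun := Bfun { bfun_val :> X -> R ; _ : bfun_val \in bfun_pred }.

HB.instance Definition _ := [isSub for bfun_val].
HB.instance Definition _ := [Choice of bfun by <:].
HB.instance Definition _ := [SubChoice_isSubLmodule of bfun by <:].

Lemma bfun_bounded (u : bfun) : exists C : R, forall x, `|u x| <= C.
Proof. by have := valP u; rewrite inE. Qed.

Lemma bfun_sumE (I : Type) (s : seq I) (u : I -> bfun) x :
  (\sum_(i <- s) u i : bfun) x = \sum_(i <- s) u i x.
Proof. by elim/big_rec2 : _ => //= i a b _ <-. Qed.

Lemma indic_bfun_pred (A : set X) : (\1_A : X -> R) \in bfun_pred.
Proof.
rewrite inE; exists 1 => x; rewrite indicE.
by case: (_ \in _); rewrite ?normr0 ?normr1.
Qed.

Definition bindic (A : set X) : bfun := Bfun (indic_bfun_pred A).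

Lemma bindic_in (A : set X) x : A x -> bindic A x = 1.
Proof. by move=> Ax; rewrite /= indicE mem_set. Qed.

Lemma bindic_notin (A : set X) x : ~ A x -> bindic A x = 0.
Proof. by move=> Ax; rewrite /= indicE memNset. Qed.

Lemma bindic_ge0 (A : set X) x : 0 <= bindic A x.
Proof. by rewrite /= indicE ler0n. Qed.

End bounded_functions.
Arguments bfun R X : clear implicits.

(** * Summable weights, finite covers and disjoint neighbourhoods *)

Lemma sum_pow2_le1 (R : realType) (s : seq nat) : uniq s ->
  \sum_(k <- s) 2^-1 ^+ k.+1 <= 1 :> R.
Proof.
move=> us; pose N := (\max_(k <- s) k.+1)%N.
have sN k : k \in s -> (k < N)%N.
  by move=> ks; rewrite /N (big_rem k)//= leq_max leqnn.
have pow_ge0 k : 0 <= 2^-1 ^+ k :> R by rewrite exprn_ge0// invr_ge0.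
have sE : perm_eq s [seq k <- iota 0 N | k \in s].
  apply: uniq_perm => //; first exact/filter_uniq/iota_uniq.
  move=> k; rewrite mem_filter mem_iota add0n leq0n /=.
  by apply/idP/andP => [ks|[]//]; split => //; exact: sN.
rewrite (perm_big _ sE) big_filter big_mkcond/=.
have geo n : \sum_(k <- iota 0 n) 2^-1 ^+ k.+1 = 1 - 2^-1 ^+ n :> R.
  elim: n => [|n IH]; first by rewrite big_nil expr0 subrr.
  by rewrite -addn1 iotaD big_cat IH big_seq1 add0n addn1 exprS /=; lra.
apply: (@le_trans _ _ (\sum_(k <- iota 0 N) 2^-1 ^+ k.+1)).
  by apply: ler_sum => k _; case: ifP.
by rewrite geo lerBlDr lerDl.
Qed.

Lemma countable_weights (R : realType) (X : choiceType) :
  countable [set: X] ->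
  exists2 w : X -> R, (forall x, 0 < w x) &
    forall s, uniq s -> \sum_(x <- s) w x <= 1.
Proof.
move=> /countable_injP[n /in2TT n_inj].
exists (fun x => 2^-1 ^+ (n x).+1) => [x|s us].
  by rewrite exprn_gt0// invr_gt0.
rewrite -(big_map n xpredT (fun k => 2^-1 ^+ k.+1)) sum_pow2_le1//.
by rewrite map_inj_uniq// => x y; apply: n_inj; rewrite inE.
Qed.

(** Compactness is used through near coverings: the index is a finite list of
    points, and the filter is that of the lists containing a given list. *)
Lemma compact_nbhs_cover (X : topologicalType) (K : set X) (N : X -> set X) :
  compact K -> (forall z, nbhs z (N z)) ->
  exists s : seq X, forall x, K x -> exists2 z, z \in s & N z x.
Proof.
move=> /compact_near_coveringP cK nN.
pose F : set_system (seq X) :=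
  filter_from [set: seq X] (fun s => [set t : seq X | {subset s <= t}]).
have FF : Filter F.
  apply: filter_from_filter; first by exists [::].
  move=> s t _ _; exists (s ++ t) => // r str; split=> x xs; apply: str;
    by rewrite mem_cat xs ?orbT.
have [x _|s _ sP] := cK _ F (fun s x => exists2 z, z \in s & N z x) FF.
  exists (N x, [set t : seq X | {subset [:: x] <= t}]) => /=.
    by split; [exact: nN|exists [:: x]].
  by move=> [y t] /= [Ny xt]; exists x => //; apply: xt; rewrite inE.
by exists s => x Kx; exact: (sP s).
Qed.

Lemma disjoint_nbhs (X : topologicalType) (F : seq X) : hausdorff_space X ->
  exists2 W : X -> set X, forall z, nbhs z (W z) &
    forall z w x, z \in F -> w \in F -> W z x -> W w x -> z = w.
Proof.
rewrite open_hausdorff => hX.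
have /choice[D DP] (q : X * X) : exists AB : set X * set X,
    q.1 != q.2 -> [/\ nbhs q.1 AB.1, nbhs q.2 AB.2 & AB.1 `&` AB.2 = set0].
  have [_|/hX[[A B] /= [Az Bw] [oA oB /eqP AB]]] := eqVneq q.1 q.2.
    by exists (set0, set0).
  by exists (A, B) => _; split => //; apply: open_nbhs_nbhs; split=> //;
    rewrite -in_setE.
pose W z := [set x | forall w, w \in F -> w != z ->
  (D (z, w)).1 x /\ (D (w, z)).2 x].
exists W => [z|z w x zF wF zx wx].
  rewrite /W; elim: F {W} => [|v F IH]; first exact: nearW.
  have [<-|vz] := eqVneq z v.
    apply: filterS IH => x xF w; rewrite inE => /orP[/eqP ->|]; first by rewrite eqxx.
    exact: xF.
  have zv : v != z by rewrite eq_sym.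
  have [/= z1 _ _] := DP (z, v) vz; have [/= _ z2 _] := DP (v, z) zv.
  apply: filterS3 IH z1 z2 => x xF x1 x2 w.
  by rewrite inE => /orP[/eqP -> //|]; exact: xF.
apply/eqP; apply: contrapT => /negP zw.
have [_ _ /seteqP[/(_ x)/= h _]] := DP (z, w) zw; apply: h; split.
  by apply: (zx w wF _).1; rewrite eq_sym.
by apply: (wx z zF _).2.
Qed.

(** * Atoms of a positive functional *)

Section positive_functional.
Context {R : realType} {X : topologicalType} (L : {linear bfun R X -> R^o}).
Hypothesis L_ge0 : forall u : bfun R X, (forall x, 0 <= u x) -> 0 <= L u.

Lemma positive_le (u v : bfun R X) : (forall x, u x <= v x) -> L u <= L v.
Proof.
move=> uv; rewrite -subr_ge0 -(linearB L); apply: L_ge0 => x.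
have -> : (v - u) x = v x - u x by [].
by rewrite subr_ge0.
Qed.

Lemma positive_norm_le (u v : bfun R X) :
  (forall x, `|u x| <= v x) -> `|L u| <= L v.
Proof.
move=> uv; rewrite ler_norml lerNl -linearN; apply/andP.
split; apply: positive_le => x; have := uv x; rewrite ler_norml => /andP[]//.
by have -> : (- u) x = - u x by []; rewrite lerNl.
Qed.

Definition mass (A : set X) : R := L (bindic A).

Lemma mass_ge0 A : 0 <= mass A.
Proof. by apply: L_ge0 => x; exact: bindic_ge0. Qed.

Lemma le_mass A B : A `<=` B -> mass A <= mass B.
Proof.
move=> AB; apply: positive_le => x.
have [Ax|Ax] := pselect (A x); last by rewrite bindic_notin// bindic_ge0.
by rewrite !bindic_in//; exact: AB.
Qed.

(** On a countable space a finitely additive measure need not be carried by its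
    point masses [mass [set z]]; the infimum over neighbourhoods also collects the
    mass that accumulates at [z], and this is what continuous functions see. *)
Definition atom (z : X) : R := inf [set mass U | U in nbhs z].

Lemma atom_le z U : nbhs z U -> atom z <= mass U.
Proof.
move=> zU; apply: ge_inf; last by exists U.
by exists 0 => _ [A _ <-]; exact: mass_ge0.
Qed.

Lemma atom_nbhs z (e : R) : 0 < e -> exists2 U, nbhs z U & mass U <= atom z + e.
Proof.
move=> e0.
have [|_ [U zU <-] /ltW Ue] := @inf_adherent _ [set mass U | U in nbhs z] _ e0.
  split; first by exists (mass setT), setT => //; exact: filterT.
  by exists 0 => _ [A _ <-]; exact: mass_ge0.
by exists U.
Qed.

Lemma sum_disjoint_indic (F : seq X) (N : X -> set X) (c : X -> R) z x :
  uniq F -> (forall z w, z \in F -> w \in F -> N z x -> N w x -> z = w) ->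
  z \in F -> N z x -> \sum_(w <- F) c w * (bindic (N w) : bfun R X) x = c z.
Proof.
move=> uF dN zF Nz; rewrite (bigD1_seq z)// big_seq_cond big1 => [|w].
  by rewrite bindic_in// mulr1; exact: addr0.
move=> /andP[wF wz]; rewrite bindic_notin ?mulr0// => Nw.
by move/eqP: wz; apply; exact: dN.
Qed.

Lemma sum_notin_indic (F : seq X) (N : X -> set X) (c : X -> R) x :
  (forall z, z \in F -> ~ N z x) ->
  \sum_(w <- F) c w * (bindic (N w) : bfun R X) x = 0.
Proof.
by move=> nN; rewrite big_seq big1// => w wF; rewrite bindic_notin ?mulr0//; exact: nN.
Qed.

Lemma sum_atom_le (F : seq X) : hausdorff_space X -> uniq F ->
  \sum_(z <- F) atom z <= mass setT.
Proof.
move=> hX uF; have [W zW dW] := disjoint_nbhs F hX.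
apply: (@le_trans _ _ (\sum_(z <- F) mass (W z))).
  by apply: ler_sum => z _; exact: atom_le.
rewrite -linear_sum; apply: positive_le => x; rewrite bfun_sumE bindic_in//.
rewrite (eq_bigr (fun z => 1 * (bindic (W z) : bfun R X) x)); last first.
  by move=> z _; rewrite mul1r.
have [[z zF Wz]|no] := pselect (exists2 z, z \in F & W z x).
  rewrite (sum_disjoint_indic (fun=> 1) uF _ zF Wz)// => v w.
  exact: dW.
by rewrite (sum_notin_indic (fun=> 1))// => z zF Wz; apply: no; exists z.
Qed.

(** The atoms have a bounded sum, so a finite set whose sum is nearly the
    supremum leaves little for any finite set outside it. *)
Lemma atoms_small_tail (eps : R) : hausdorff_space X -> 0 < eps ->
  exists2 F : seq X, uniq F & forall G, uniq G ->
    (forall z, z \in G -> z \notin F) -> \sum_(z <- G) atom z <= eps.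
Proof.
move=> hX e0; pose A := [set \sum_(z <- F) atom z | F in [set F : seq X | uniq F]].
have supA : has_sup A.
  split; first by exists (\sum_(z <- [::]) atom z), [::].
  by exists (mass setT) => _ [F uF <-]; exact: sum_atom_le.
have [_ [F uF <-] FA] := sup_adherent e0 supA.
exists F => // G uG GF.
have : \sum_(z <- F ++ G) atom z <= sup A.
  apply: ub_le_sup; first exact: supA.2.
  exists (F ++ G) => //=; rewrite cat_uniq uF uG andbT /=.
  by apply/hasPn => z /GF.
by rewrite big_cat /=; lra.
Qed.

(** Riesz representation in the only form needed: on a countable space, up to
    [eps], a positive functional acts on the continuous functions vanishing at
    infinity as finitely many atoms, with [F] chosen before [f].

    Small neighbourhoods of the points of [F] account for the finite sum. What
    remains of a compact set is covered by finitely many small neighbourhoods of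
    points outside [F]; countability lets the errors in their masses be summable,
    so their total mass barely exceeds the sum of their atoms, which is small by
    the choice of [F]. *)
Lemma finite_atomic_approx (eps : R) :
  hausdorff_space X -> countable [set: X] -> 0 < eps ->
  exists F : seq X, forall (f : bfun R X) (C : R), 0 <= C -> continuous f ->
    (forall x, `|f x| <= C) ->
    (forall e, 0 < e -> exists2 K, compact K & forall x, ~ K x -> `|f x| <= e) ->
    `|L f - \sum_(z <- F) f z * atom z| <= eps * C.
Proof.
move=> hX cX eps0; have [F uF Ftail] := atoms_small_tail hX eps0.
have [w w0 w1] := @countable_weights R X cX.
exists F => f C C0 cf fC finf; apply/ler_addgt0Pr => e e0.
(* The denominator makes the errors below, [eta * mass setT] for the
   oscillation and [C * eta] twice for the masses, add up to at most [e]. *)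
pose eta := e / (mass setT + 2 * C + 1).
have D0 : 0 < mass setT + 2 * C + 1 by have := mass_ge0 setT; lra.
have eta0 : 0 < eta by rewrite divr_gt0.
have /choice[U UP] z : exists U, [/\ nbhs z U, mass U <= atom z + eta * w z &
    forall x, U x -> `|f x - f z| <= eta].
  have [U zU mU] := atom_nbhs z (mulr_gt0 eta0 (w0 z)).
  have /cvgrPdist_le/(_ _ eta0) fz := cf z.
  exists (U `&` [set x | `|f z - f x| <= eta]); split.
  - exact: filterI.
  - by apply: le_trans mU; apply: le_mass; exact: subIsetl.
  - by move=> x [_ /=]; rewrite distrC.
have [W zW dW] := disjoint_nbhs F hX.
pose N z := if z \in F then U z `&` W z else U z.
have NU z : N z `<=` U z by move=> x; rewrite /N; case: ifP => // _ [].
have zN z : nbhs z (N z).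
  by have [zU _ _] := UP z; rewrite /N; case: ifP => // _; exact: filterI.
have dN z v x : z \in F -> v \in F -> N z x -> N v x -> z = v.
  by move=> zF vF; rewrite /N zF vF => -[_ ?] [_ ?]; exact: (dW z v x).
have mN z : mass (N z) <= atom z + eta * w z.
  by have [_ mU _] := UP z; apply: le_trans mU; exact: le_mass.
have [K cK fK] := finf _ eta0.
have [s Ks] := compact_nbhs_cover cK zN.
pose G := undup [seq z <- s | z \notin F].
have uG : uniq G by rewrite undup_uniq.
have GF z : z \in G -> z \notin F by rewrite mem_undup mem_filter => /andP[].
pose g : bfun R X := \sum_(z <- F) f z *: bindic (N z).
pose v : bfun R X := eta *: bindic setT + C *: \sum_(z <- G) bindic (N z).
have gE x : g x = \sum_(z <- F) f z * (bindic (N z) : bfun R X) x.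
  by rewrite /g bfun_sumE.
have vE x : v x = eta + C * \sum_(z <- G) (bindic (N z) : bfun R X) x.
  rewrite -bfun_sumE -[X in X + _]mulr1.
  by rewrite -[X in _ * X + _](bindic_in (A := setT) (x := x)).
(* Near [F] only the oscillation of [f] is left; elsewhere in [K] the bound [C]
   is paid on the neighbourhoods indexed by [G]; outside [K], [f] is small. *)
have fgv x : `|(f - g) x| <= v x.
  have -> : (f - g) x = f x - g x by [].
  rewrite gE vE.
  have sG : 0 <= \sum_(z <- G) (bindic (N z) : bfun R X) x.
    by apply: sumr_ge0 => z _; exact: bindic_ge0.
  have [[z zF Nz]|no] := pselect (exists2 z, z \in F & N z x).
    rewrite (sum_disjoint_indic f uF _ zF Nz); last by move=> ? ?; exact: dN.
    have [_ _ /(_ x (NU _ _ Nz))] := UP z.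
    by have := mulr_ge0 C0 sG; lra.
  rewrite sum_notin_indic ?subr0; last by move=> z zF Nz; apply: no; exists z.
  have [Kx|/fK] := pselect (K x); last by have := mulr_ge0 C0 sG; lra.
  have [z zs Nz] := Ks _ Kx.
  have zG : z \in G.
    by rewrite mem_undup mem_filter zs andbT; apply/negP => zF; apply: no; exists z.
  have sG1 : 1 <= \sum_(z <- G) (bindic (N z) : bfun R X) x.
    rewrite (bigD1_seq z)// bindic_in//= lerDl sumr_ge0//.
  by have := fC x; have := ler_wpM2l C0 sG1; lra.
have Lv : L v <= eta * mass setT + C * (eps + eta).
  rewrite linearD !linearZ /= linear_sum lerD// ler_wpM2l//.
  apply: (@le_trans _ _ (\sum_(z <- G) (atom z + eta * w z))).
    by apply: ler_sum => z _; exact: mN.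
  rewrite big_split/= lerD ?Ftail// -mulr_sumr.
  by rewrite ler_piMr ?w1// ltW.
have Lg : `|L g - \sum_(z <- F) f z * atom z| <= C * eta.
  rewrite linear_sum -sumrB (le_trans (ler_norm_sum _ _ _))//.
  apply: (@le_trans _ _ (\sum_(z <- F) C * (eta * w z))).
    apply: ler_sum => z _; rewrite linearZ /= -mulrBr normrM.
    apply: ler_pM => //; rewrite ger0_norm ?subr_ge0 ?atom_le//.
    by have := mN z; rewrite /mass; lra.
  by rewrite -!mulr_sumr ler_wpM2l// ler_piMr ?w1// ltW.
have Lfg : `|L f - L g| <= L v by rewrite -linearB; exact: positive_norm_le.
have etaE : eta * (mass setT + 2 * C + 1) = e by rewrite divfK// gt_eqF.
by apply: le_trans (ler_distD (L g) _ _) _; lra.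
Qed.

End positive_functional.

(** * Locally constant flattening of Lipschitz functions *)

Lemma dist_max_le (R : realDomainType) (a b a' b' c : R) :
  `|a - a'| <= c -> `|b - b'| <= c ->
  `|Num.max a b - Num.max a' b'| <= c.
Proof.
rewrite !ler_norml => /andP[h1 h2] /andP[h3 h4].
by case: (leP a b) => ?; case: (leP a' b') => ?; apply/andP; split; lra.
Qed.

Lemma dist_min_le (R : realDomainType) (a b a' b' c : R) :
  `|a - a'| <= c -> `|b - b'| <= c ->
  `|Num.min a b - Num.min a' b'| <= c.
Proof.
rewrite !ler_norml => /andP[h1 h2] /andP[h3 h4].
by case: (leP a b) => ?; case: (leP a' b') => ?; apply/andP; split; lra.
Qed.

(** Each interval is squashed to a point by the map [c] below, which is constant
    between [phi l] and [phi r] and has slope one elsewhere. Intervals are treated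
    one after the other: a monotone short map sends the next interval to an
    interval that is no longer than it, so at most the total length is lost. *)
Lemma collapse_intervals (R : realFieldType) (s : seq (R * R)) :
  (forall I, I \in s -> I.1 <= I.2) ->
  exists phi : R -> R,
    [/\ forall a b, a <= b -> 0 <= phi b - phi a <= b - a,
        forall I, I \in s -> forall t u,
          I.1 <= t <= I.2 -> I.1 <= u <= I.2 -> phi t = phi u &
        forall a b, a <= b ->
          (b - a) - (phi b - phi a) <= \sum_(I <- s) (I.2 - I.1)].
Proof.
elim: s => [_|[l r] s IH sP].
  exists id; split=> [a b ab|//|a b ab]; last by rewrite subrr big_nil.
  by rewrite lexx subr_ge0 ab.
have [phi [phi1 phic phis]] : _ := IH (fun I Is => sP I (mem_behead (s := _ :: _) Is)).
have lr : l <= r by apply: (sP (l, r)); rewrite inE eqxx.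
have plr : phi l <= phi r by have /andP[+ _] := phi1 _ _ lr; rewrite subr_ge0.
pose c t := Num.min t (phi l) + Num.max t (phi r).
have cP a b : a <= b -> [/\ 0 <= c b - c a, c b - c a <= b - a &
    (b - a) - (c b - c a) <= phi r - phi l].
  rewrite /c => ab.
  by case: (leP a (phi l)) => ?; case: (leP a (phi r)) => ?;
     case: (leP b (phi l)) => ?; case: (leP b (phi r)) => ?; split; lra.
exists (c \o phi); split => [a b ab|I|a b ab] /=.
- have /andP[p0 p1] := phi1 _ _ ab.
  have [|c0 c1 _] := cP (phi a) (phi b); first by rewrite -subr_ge0.
  by rewrite c0/=; lra.
- rewrite inE => /orP[/eqP ->|Is t u tI uI]; last by rewrite (phic I Is t u).
  suff h t : l <= t <= r -> c (phi t) = phi l + phi r.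
    by move=> t u /= /h -> /h ->.
  move=> /andP[lt tr]; have /andP[h1 _] := phi1 _ _ lt.
  have /andP[h2 _] := phi1 _ _ tr; rewrite /c.
  by case: (leP (phi t) (phi l)) => ?; case: (leP (phi t) (phi r)) => ?; lra.
- have /andP[p0 p1] := phi1 _ _ ab; have := phis _ _ ab.
  have /andP[_ q1] := phi1 _ _ lr; rewrite big_cons /=.
  have [|_ _ c2] := cP (phi a) (phi b); first by rewrite -subr_ge0.
  lra.
Qed.

Lemma seq_pos_lbound (R : realDomainType) (T : eqType) (F : T -> R) (s : seq T) :
  (forall x, 0 < F x) ->
  exists d : R, [/\ 0 < d, d <= 1 & forall x, x \in s -> d <= F x].
Proof.
move=> F0; elim: s => [|x s [d [d0 d1 ds]]]; first by exists 1.
exists (Num.min (F x) d); split; first by rewrite lt_min F0.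
  by rewrite ge_min d1 orbT.
move=> y; rewrite inE ge_min => /orP[/eqP ->|/ds ->]; rewrite ?lexx ?orbT//.
Qed.

Section approximation.
Context {R : realType} {M : metricType R} (o : M).
Hypotheses (countableM : countable [set: M]) (properM : proper_metric M).

(** Clamping [f] between [- h] and [h], where [h] is the positive part of
    [2 * r - mdist x o], keeps the Lipschitz constant, since lattice operations
    do. On the ball of radius [r] it changes nothing, because there
    [`|f x| <= mdist x o <= h x]. *)
Lemma truncation (f : Lip0 o) (r : R) :
  0 <= r -> (forall x y, `|f x - f y| <= mdist x y) ->
  exists k : M -> R, [/\ k o = 0, forall x y, `|k x - k y| <= mdist x y,
    forall x, 2 * r <= mdist x o -> k x = 0 &
    forall x, mdist x o <= r -> k x = f x].
Proof.
move=> r0 f1; pose h x : R := Num.max 0 (2 * r - mdist x o).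
have h0 x : 0 <= h x by rewrite le_max lexx.
have h1 x y : `|h x - h y| <= mdist x y.
  apply: dist_max_le; first by rewrite subrr normr0 mdist_ge0.
  have := metric_triangle x y o; have := metric_triangle y x o.
  by rewrite (metric_sym y x) ler_norml => ? ?; apply/andP; split; lra.
exists (fun x => Num.max (- h x) (Num.min (f x) (h x))); split=> [|x y|x rx|x xr].
- rewrite Lip0_base; have := h0 o; rewrite /Num.max /Num.min => h00.
  by case: (ltP 0 (h o)) => ?; case: ltP => ?; lra.
- apply: dist_max_le; first by rewrite -opprD normrN.
  exact: dist_min_le.
- have -> : h x = 0 by apply/max_idPl; lra.
  by rewrite oppr0; case: (leP (f x) 0) => ?; case: leP => ?; lra.
- have : `|f x| <= r by rewrite -[f x]subr0 -(Lip0_base f) (le_trans (f1 _ _)).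
  have : r <= h x by rewrite le_max; apply/orP; right; lra.
  rewrite ler_norml => ? /andP[? ?].
  by case: (leP (f x) (h x)) => ?; case: leP => ?; lra.
Qed.

(** The image of [k] is countable, hence of measure zero, so it is covered by
    intervals of small total length, finitely many of which suffice over a compact
    set. Collapsing these moves points by at most their total length and
    makes [phi \o k] constant on balls of a uniform radius centred in [K]. *)
Lemma flatten_locally (k : M -> R) (K : set M) (e : R) :
  compact K -> 0 < e -> (forall x y, `|k x - k y| <= mdist x y) ->
  exists phi : R -> R,
    [/\ forall a b, `|phi a - phi b| <= `|a - b|,
        forall t, `|phi t - phi 0 - t| <= e &
        exists2 d : R, 0 < d <= 1 & forall x y, K x -> mdist x y < d ->
          phi (k x) = phi (k y)].
Proof.
move=> cK e0 k1; have [w w0 w1] := @countable_weights R M countableM.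
pose eta x := e / 2 * w x.
have eta0 x : 0 < eta x by rewrite mulr_gt0// divr_gt0.
have e20 x : 0 < eta x / 2 by rewrite divr_gt0.
have [s0 s0P] := compact_nbhs_cover cK (fun x => nbhsx_ballx x _ (e20 x)).
pose s := undup s0.
have [|phi [phi1 phic phis]] :=
    @collapse_intervals R [seq (k x - eta x, k x + eta x) | x <- s].
  by move=> _ /mapP[x _ ->] /=; have := eta0 x; lra.
have tot : \sum_(I <- [seq (k x - eta x, k x + eta x) | x <- s]) (I.2 - I.1) <= e.
  rewrite big_map /= (eq_bigr (fun x => e * w x)) => [|x _].
    by rewrite -mulr_sumr ler_piMr ?w1 ?undup_uniq// ltW.
  by rewrite /eta; field.
exists phi; split=> [a b|t|].
- have [ab|/ltW ba] := leP a b.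
    by have /andP[h1 h2] := phi1 _ _ ab; rewrite ler0_norm ?ler0_norm; lra.
  by have /andP[h1 h2] := phi1 _ _ ba; rewrite ger0_norm ?ger0_norm; lra.
- have [t0|/ltW t0] := leP t 0.
    have /andP[h1 h2] := phi1 _ _ t0; have := phis _ _ t0.
    by rewrite ger0_norm; lra.
  have /andP[h1 h2] := phi1 _ _ t0; have := phis _ _ t0.
  by rewrite ler0_norm; lra.
- have [d [d0 d1 ds]] := seq_pos_lbound s e20.
  exists d; first by rewrite d0.
  move=> x y Kx xyd; have [z zs0] := s0P _ Kx; rewrite ballEmdist /= => zx.
  have zs : z \in s by rewrite mem_undup.
  have := ds _ zs; have := k1 z x; have := k1 z y; have := metric_triangle z x y.
  rewrite !ler_norml => ? /andP[? ?] /andP[? ?] ?.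
  apply: (phic (k z - eta z, k z + eta z)) => /=; first by apply/mapP; exists z.
    by apply/andP; split; lra.
  by apply/andP; split; lra.
Qed.

(** The unit ball of S is dense in the unit ball of [Lip0], uniformly on bounded
    sets: truncate, then flatten. The result is locally constant at a uniform
    scale, hence little Lipschitz; it is bounded and vanishes outside a ball,
    hence its slopes decay at infinity. *)
Lemma S_approximation (f : Lip0 o) (r e : R) : 0 <= r -> 0 < e ->
  (forall x y, `|f x - f y| <= mdist x y) ->
  exists g : Lip0 o, [/\ g \in @S_pred R M o,
    forall x y, `|g x - g y| <= mdist x y &
    forall x, mdist x o <= r -> `|f x - g x| <= e].
Proof.
move=> r0 e0 f1; have [k [ko k1 kout kin]] := truncation r0 f1.
have [phi [phi1 phie [d /andP[d0 d1] phid]]] :=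
  (* The margin [1] is at least [d], so a point within [d] of a point outside
     the larger ball is outside the support of [k]. *)
  flatten_locally (@properM o (2 * r + 1)) e0 k1.
pose g x := phi (k x) - phi 0.
have g1 x y : `|g x - g y| <= mdist x y.
  by rewrite opprB addrA subrK (le_trans (phi1 _ _)).
have go : g o = 0 by rewrite /g ko subrr.
have gL : g \in @Lip0_pred R M o.
  by rewrite inE; split=> //; exists 1 => x y; rewrite mul1r.
have gout x : 2 * r <= mdist x o -> g x = 0.
  by move=> /kout; rewrite /g => ->; rewrite subrr.
have gb x : `|g x| <= 2 * r.
  have [/gout ->|/ltW xr] := leP (2 * r) (mdist x o).
    by rewrite normr0 mulr_ge0.
  by rewrite -[g x]subr0 -go (le_trans (g1 _ _)).
have gfar (e' rho : R) x y : 0 < e' -> 2 * r + 2 * r / e' <= rho ->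
    rho < mdist x o -> `|g x - g y| <= e' * mdist x y.
  move=> e'0 rhoP xrho.
  have rrho : 2 * r <= rho.
    by rewrite (le_trans _ rhoP)// lerDl divr_ge0 ?mulr_ge0// ltW.
  have -> : g x = 0 by apply: gout; lra.
  rewrite sub0r normrN.
  have [/gout ->|yr] := leP (2 * r) (mdist y o).
    by rewrite normr0 mulr_ge0 ?mdist_ge0// ltW.
  rewrite (le_trans (gb _))// [leRHS]mulrC -ler_pdivrMr//.
  move: rhoP; set q := _ / e' => ?.
  by have := metric_triangle x y o; lra.
exists (MkLip0 gL); split=> [|//|x xr] /=; last first.
  by rewrite distrC -(kin _ xr) phie.
rewrite inE; split=> [e' e'0|].
  exists d => // x y xyd /=.
  suff -> : g x = g y by rewrite subrr normr0 mulr_ge0 ?mdist_ge0// ltW.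
  have [xB|xB] := pselect (mdist_closed_ball o (2 * r + 1) x).
    by rewrite /g (phid x y).
  have {}xB : 2 * r + 1 < mdist x o.
    by rewrite ltNge metric_sym; apply/negP.
  have := metric_triangle x y o => ?.
  by rewrite !gout//; lra.
apply/cvgrPdist_le => e' e'0.
near=> rho.
have rhoP : 2 * r + 2 * r / e' <= rho.
  by near: rho; apply: nbhs_pinfty_ge; exact: num_real.
rewrite sub0r normrN ger0_norm ?tail_slope_ge0//.
apply: tail_slope_lub => [|x y]; first exact: ltW.
have far z : ~ mdist_closed_ball o rho z -> rho < mdist z o.
  by move=> h; rewrite ltNge metric_sym; apply/negP.
move=> [/far|/far] h; first exact: gfar h.
by rewrite distrC metric_sym; exact: gfar h.
Unshelve. all: by end_near. Qed.

End approximation.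

(** * Duals, restrictions and closed spans *)

Section dual_complements.
Context {R : realType}.

Lemma bounded_dual_pred (V : normedModType R) (l : V -> R) :
  linear (l : V -> R^o) -> (exists k : R, forall x, `|l x| <= k * `|x|) ->
  l \in @dual_pred R V.
Proof.
move=> ll [k lk]; rewrite inE; split=> //=.
pose L : {linear V -> R^o} :=
  HB.pack (l : V -> R^o) (GRing.isLinear.Build _ _ _ _ _ ll).
suff: continuous L by [].
apply/linear_bounded_continuous/bounded_funP => r.
exists (`|k| * r) => x xr /=; rewrite (le_trans (lk x))//.
rewrite (le_trans (ler_wpM2r _ (ler_norm k)))//.
by rewrite ler_wpM2l.
Qed.

Lemma dual_sumE (V : normedModType R) (I : Type) (s : seq I) (phi : I -> dual V)
  (x : V) : (\sum_(i <- s) phi i : dual V) x = \sum_(i <- s) phi i x.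
Proof. by elim/big_rec2 : _ => //= i a b _ <-. Qed.

Lemma dual_restr_pred (V : normedModType R) (A : submodClosed V) (phi : dual V) :
  (fun u : normed_subspace A => phi (\val u)) \in @dual_pred R (normed_subspace A).
Proof.
apply: bounded_dual_pred => [a u v|].
  by rewrite (dual_linear phi a (\val u) (\val v)).
by exists (op_norm phi) => u; exact: op_norm_le.
Qed.

Definition dual_restr (V : normedModType R) (A : submodClosed V) (phi : dual V) :
  dual (normed_subspace A) := Dual (dual_restr_pred A phi).

(** Completeness of the dual, for a family indexed by its own error bound. The
    limit at [x] is taken as the supremum of the lower ends of the intervals of
    radius [e * `|x|] around [phi e x]; these intervals meet pairwise, so the
    supremum lies in all of them. *)
Lemma dual_limit (V : normedModType R) (phi : R -> dual V) :
  (forall d e, 0 < d -> 0 < e -> `|phi d - phi e| <= d + e) ->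
  exists psi : dual V, forall e, 0 < e -> `|phi e - psi| <= e.
Proof.
move=> phiC.
have phiCx d e x : 0 < d -> 0 < e -> `|phi d x - phi e x| <= (d + e) * `|x|.
  move=> d0 e0; apply: (le_trans (op_norm_le (phi d - phi e) x)).
  by rewrite ler_wpM2r//; exact: phiC.
pose A x := [set phi e x - e * `|x| | e in [set e : R | 0 < e]].
have Aub x e : 0 < e -> ubound (A x) (phi e x + e * `|x|).
  move=> e0 _ [d /= d0 <-]; have := phiCx _ _ x d0 e0.
  by rewrite ler_norml mulrDl => /andP[_]; lra.
pose psi x := sup (A x).
have psiP e x : 0 < e -> `|phi e x - psi x| <= e * `|x|.
  move=> e0.
  have h1 : psi x <= phi e x + e * `|x|.
    by apply: ge_sup; [exists (phi 1 x - 1 * `|x|), 1 => //=|exact: Aub].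
  have h2 : phi e x - e * `|x| <= psi x.
    by apply: ub_le_sup; [exists (phi 1 x + 1 * `|x|); exact: Aub|exists e].
  by rewrite ler_norml; apply/andP; split; lra.
have psi_lin : linear (psi : V -> R^o).
  move=> a x y; apply/eqP; rewrite -subr_eq0 -normr_le0; apply/ler_addgt0Pr => e e0.
  pose D := `|a *: x + y| + `|a| * `|x| + `|y| + 1.
  have D0 : 0 < D by rewrite ltr_wpDl// !addr_ge0// mulr_ge0.
  pose d := e / D; have d0 : 0 < d by rewrite divr_gt0.
  have E : phi d (a *: x + y) = a * phi d x + phi d y := dual_linear (phi d) a x y.
  have hx : `|a * phi d x - a * psi x| <= `|a| * (d * `|x|).
    by rewrite -mulrBr normrM ler_wpM2l// psiP.
  have hy := psiP _ y d0; have hxy := psiP _ (a *: x + y) d0.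
  have dD : d * D = e by rewrite divfK// gt_eqF.
  move: dD hx hy hxy; rewrite E /D add0r !ler_norml !mulrDr mulrCA.
  have -> : a *: (psi x : R^o) = a * psi x by [].
  by move=> dD /andP[? ?] /andP[? ?] /andP[? ?]; apply/andP; split; lra.
have psi_dual : psi \in @dual_pred R V.
  apply: bounded_dual_pred => //; exists (op_norm (phi 1) + 1) => x.
  have := psiP 1 x ltr01; have := op_norm_le (phi 1) x.
  rewrite mulrDl !ler_norml => /andP[? ?] /andP[? ?]; apply/andP; split; lra.
exists (Dual psi_dual) => e e0.
by apply: op_norm_lub => [|x]; [exact: ltW|exact: psiP].
Qed.

Lemma closed_span_limit (V : normedModType R) (A : set V) (v : V) :
  (forall e : R, 0 < e -> exists2 u, u \in closed_span A & `|u - v| <= e) ->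
  v \in closed_span A.
Proof.
move=> h; rewrite inE; apply: closed_closure => B /nbhs_ballP[e /= e0 eB].
have e20 : 0 < e / 2 by rewrite divr_gt0.
have [u] := h _ e20; rewrite inE => uA uv; exists u; split => //.
by apply: eB; rewrite -ball_normE /ball_/= distrC; lra.
Qed.

Lemma sub_closed_span (V : normedModType R) (A : set V) (v : V) :
  A v -> v \in closed_span A.
Proof.
move=> Av; rewrite inE; apply: subset_closure.
exists 1%N, (fun=> 1), (fun=> v); split => //.
by rewrite big_ord1 scale1r.
Qed.

End dual_complements.

Lemma hausdorff_prod (X Y : topologicalType) :
  hausdorff_space X -> hausdorff_space Y -> hausdorff_space (X * Y)%type.
Proof.
move=> hX hY [x y] [x' y'] xy; congr (_, _).
- apply: hX => A B xA xB; have [||[u v] [/= Au Bu]] := xy (A `*` setT) (B `*` setT).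
  + by exists (A, setT) => //=; split=> //; exact: filterT.
  + by exists (B, setT) => //=; split=> //; exact: filterT.
  by case: Au => Au _; case: Bu => Bu _; exists u.
- apply: hY => A B yA yB; have [||[u v] [/= Au Bu]] := xy (setT `*` A) (setT `*` B).
  + by exists (setT, A) => //=; split=> //; exact: filterT.
  + by exists (setT, B) => //=; split=> //; exact: filterT.
  by case: Au => _ Au; case: Bu => _ Bu; exists v.
Qed.

(** * The unit ball of S norms the free space *)

Section one_norming.
Context {R : realType} {M : metricType R} (o : M).
Hypotheses (countableM : countable [set: M]) (properM : proper_metric M).

Local Notation restrS := (dual_restr (@S_pred R M o)).

(** A finite combination of evaluations only sees finitely many points, all in
    one ball: this is what turns approximation on balls into approximation of
    pairings. *)
Lemma lin_span_delta_continuous (phi : dual (Lip0 o)) (e : R) : 0 < e ->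
  lin_span (range (@delta R M o)) phi ->
  exists r d : R, [/\ 0 <= r, 0 < d & forall f g : Lip0 o,
    (forall x, mdist x o <= r -> `|f x - g x| <= d) -> `|phi f - phi g| <= e].
Proof.
move=> e0 [n [a [x [Ax ->]]]].
have /choice[y yP] i : exists z, delta o z = x i by have [z _ zx] := Ax i; exists z.
pose D := \sum_(i < n) `|a i| + 1.
have D0 : 0 < D by rewrite ltr_wpDl// sumr_ge0.
(* The sum of the distances is a radius that works for all the points. *)
exists (\sum_(i < n) mdist (y i) o), (e / D).
split; [by rewrite sumr_ge0// => i _; exact: mdist_ge0|by rewrite divr_gt0|].
move=> f g fg.
have sE h : (\sum_(i < n) a i *: x i : dual (Lip0 o)) h = \sum_(i < n) a i * h (y i).
  by rewrite dual_sumE; apply: eq_bigr => i _; rewrite -yP.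
rewrite !sE -sumrB (le_trans (ler_norm_sum _ _ _))//.
rewrite (@le_trans _ _ (\sum_(i < n) `|a i| * (e / D)))//.
  apply: ler_sum => i _; rewrite -mulrBr normrM ler_wpM2l//; apply: fg.
  by rewrite (bigD1 i)//= lerDl sumr_ge0// => j _; exact: mdist_ge0.
rewrite -mulr_suml mulrCA ler_piMr//; first exact: ltW.
by rewrite ler_pdivrMr// mul1r /D lerDl.
Qed.

(** Restriction to S could only decrease the norm. It does not: [mu] is nearly a
    finite combination of evaluations, for which the values at a function of the
    unit ball of [Lip0] are nearly attained on the unit ball of S. *)
Lemma restr_norm (mu : free_space o) :
  `|restrS (\val mu)| = `|mu|.
Proof.
apply/eqP; rewrite eq_le; apply/andP; split.
  apply: op_norm_lub => [|f]; first exact: op_norm_ge0.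
  exact: (op_norm_le (\val mu) (\val f)).
set K := `|dual_restr _ _|.
have K0 : 0 <= K by exact: normr_ge0.
suff main (g : Lip0 o) : (forall x y, `|g x - g y| <= mdist x y) ->
    `|(\val mu : dual _) g| <= K.
  apply: op_norm_lub => // g; have [->|g0] := eqVneq g 0.
    have -> : (\val mu : dual _) 0 = 0 := linear0 (dual_val (\val mu)).
    by rewrite !normr0 mulr0.
  have ng0 : 0 < `|g| by rewrite normr_gt0.
  have : `|(\val mu : dual _) (`|g|^-1 *: g)| <= K.
    apply: main => x y.
    have -> : (`|g|^-1 *: g) x - (`|g|^-1 *: g) y = `|g|^-1 * (g x - g y).
      by rewrite mulrBr.
    rewrite normrM ger0_norm ?invr_ge0// ler_pdivrMl//.
    exact: lip_const_le.
  have -> : (\val mu : dual _) (`|g|^-1 *: g) = `|g|^-1 * (\val mu : dual _) g.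
    exact: (linearZ_LR (dual_val (\val mu) : {linear _ -> R^o})).
  by rewrite normrM ger0_norm ?invr_ge0// ler_pdivrMl// mulrC.
move=> g1; apply/ler_addgt0Pr => e e0.
have e30 : 0 < e / 3 by rewrite divr_gt0.
have : \val mu \in closed_span (range (@delta R M o)) by exact: valP.
rewrite inE => /(_ _ (nbhsx_ballx _ _ e30)) [nu [nuspan]].
rewrite -ball_normE /ball_/= => munu.
have [r [d [r0 d0 nuP]]] := lin_span_delta_continuous e30 nuspan.
have [f [fS f1 fg]] := S_approximation countableM properM r0 d0 g1.
have nfg := nuP g f fg.
have n1 (h : Lip0 o) : (forall x y, `|h x - h y| <= mdist x y) -> `|h| <= 1.
  by move=> h1; apply: lip_const_lub => // x y; rewrite mul1r.
have close (h : Lip0 o) : (forall x y, `|h x - h y| <= mdist x y) ->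
    `|(\val mu : dual _) h - nu h| <= e / 3.
  move=> /n1 h1; apply: (le_trans (op_norm_le (\val mu - nu) h)).
  rewrite (le_trans (ler_wpM2l (op_norm_ge0 _) h1))// mulr1.
  exact: ltW.
have muf : `|(\val mu : dual _) f| <= K.
  pose f' : S_space o := NormedSubspace fS.
  apply: (le_trans (op_norm_le (restrS (\val mu)) f')).
  by rewrite -[leRHS]mulr1 ler_wpM2l//; exact: n1.
move: nfg (close g g1) (close f f1) muf; rewrite !ler_norml.
move=> /andP[? ?] /andP[? ?] /andP[? ?] /andP[? ?]; apply/andP; split; lra.
Qed.

End one_norming.

(** * Slopes of the functions in S *)

Section positive_part_sup.
Context {R : realType} {X : Type}.
Implicit Types u v : bfun R X.

(** The supremum over [X] with a point at infinity added, at which functions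
    are given the value zero. *)
Definition sup0 u : R := sup (0 |` range u).

Let has_sup0 u : has_sup (0 |` range u).
Proof.
split; first by exists 0; left.
have [C uC] := bfun_bounded u; exists `|C| => _ [->|[x _ <-]] //.
by rewrite (le_trans (ler_norm _))// (le_trans (uC x))// ler_norm.
Qed.

Lemma sup0_ge0 u : 0 <= sup0 u.
Proof. by apply: ub_le_sup; [exact: (has_sup0 u).2|left]. Qed.

Lemma le_sup0 u x : u x <= sup0 u.
Proof. by apply: ub_le_sup; [exact: (has_sup0 u).2|right; exists x]. Qed.

Lemma sup0_le u (c : R) : 0 <= c -> (forall x, u x <= c) -> sup0 u <= c.
Proof.
by move=> c0 uc; apply: ge_sup => [|_ [->|[x _ <-]]//]; exact: (has_sup0 u).1.
Qed.

Lemma sup0D u v : sup0 (u + v) <= sup0 u + sup0 v.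
Proof.
apply: sup0_le => [|x]; first by rewrite addr_ge0 ?sup0_ge0.
by apply: (lerD (le_sup0 u x) (le_sup0 v x)).
Qed.

Lemma sup0Z (t : R) u : 0 <= t -> sup0 (t *: u) = t * sup0 u.
Proof.
have le s v : 0 <= s -> sup0 (s *: v) <= s * sup0 v.
  move=> s0; apply: sup0_le => [|x]; first by rewrite mulr_ge0 ?sup0_ge0.
  exact: (ler_wpM2l s0 (le_sup0 v x)).
rewrite le_eqVlt => /orP[/eqP <-|t0].
  by apply/eqP; rewrite mul0r eq_le sup0_ge0 andbT (le_trans (le _ _ _))// mul0r.
apply/eqP; rewrite eq_le le ?(ltW t0)//= -ler_pdivlMl//.
by rewrite -[in leLHS](scalerK (lt0r_neq0 t0) u) le// invr_ge0 ltW.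
Qed.

End positive_part_sup.

Lemma subspace_val_linear (R : realType) (V : normedModType R)
  (A : submodClosed V) : linear (@subspace_val R V A).
Proof. by []. Qed.

Lemma Lip0_linE (R : realType) (M : metricType R) (o : M) (a : R)
  (f g : Lip0 o) x : (a *: f + g) x = a * f x + g x.
Proof. by []. Qed.

Section slopes.
Context {R : realType} {M : metricType R} (o : M).

(** On the diagonal the quotient is [0 / 0 = 0], which is the value that makes
    slopes of little Lipschitz functions continuous there. *)
Definition slope_fun (f : Lip0 o) (p : M * M) : R :=
  (f p.1 - f p.2) / mdist p.1 p.2.

Lemma slope_fun_le (f : Lip0 o) p : `|slope_fun f p| <= lip_const f.
Proof.
have [p12|p12] := eqVneq p.1 p.2.
  by rewrite /slope_fun p12 subrr mul0r normr0 lip_const_ge0.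
rewrite normrM normfV (ger0_norm (mdist_ge0 _ _)) ler_pdivrMr ?mdist_gt0//.
exact: lip_const_le.
Qed.

Lemma slope_fun_bfun (f : Lip0 o) : slope_fun f \in @bfun_pred R (M * M).
Proof. by rewrite inE; exists (lip_const f); exact: slope_fun_le. Qed.

Definition slope (f : S_space o) : bfun R (M * M) :=
  Bfun (slope_fun_bfun (subspace_val f)).

Lemma slope_linear : linear slope.
Proof.
move=> a f g; apply/val_inj/funext => p.
transitivity (a * slope_fun (subspace_val f) p + slope_fun (subspace_val g) p) => //.
rewrite [LHS]/(slope_fun (subspace_val (a *: f + g)) p).
have E x :
    subspace_val (a *: f + g) x = a * subspace_val f x + subspace_val g x.
  by rewrite (subspace_val_linear a (f : normed_subspace _)) Lip0_linE.
by rewrite /slope_fun !E; ring.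
Qed.

HB.instance Definition _ := GRing.isLinear.Build R (S_space o) (bfun R (M * M))
  *:%R slope slope_linear.

Lemma slope_le (f : S_space o) p : `|slope f p| <= `|f|.
Proof. exact: slope_fun_le. Qed.

(** Exchanging the two points changes the sign of a slope, so the one-sided
    supremum already dominates the norm. This symmetry is why functionals on S
    extend to positive functionals. *)
Lemma norm_le_sup0_slope (f : S_space o) : `|f| <= sup0 (slope f).
Proof.
apply: lip_const_lub; first exact: sup0_ge0.
have le x y : subspace_val f x - subspace_val f y <= sup0 (slope f) * mdist x y.
  have [->|xy] := eqVneq x y; first by rewrite subrr mdistxx mulr0.
  by rewrite -ler_pdivrMr ?mdist_gt0//; exact: (le_sup0 (slope f) (x, y)).
move=> x y; rewrite ler_norml le andbT lerNl opprB metric_sym; exact: le.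
Qed.

Lemma near_mdist_lt (x : M) (e : R) : 0 < e -> \forall y \near x, mdist x y < e.
Proof. by move=> e0; have := nbhsx_ballx x _ e0; rewrite ballEmdist. Qed.

Lemma Lip0_continuous (f : Lip0 o) : continuous f.
Proof.
move=> x; apply/cvgrPdist_le => e e0.
have D0 : 0 < lip_const f + 1 by rewrite ltr_wpDl// lip_const_ge0.
near=> y; rewrite (le_trans (lip_const_le f x y))//.
rewrite (@le_trans _ _ ((lip_const f + 1) * mdist x y))//.
  by rewrite ler_wpM2r ?mdist_ge0// lerDl.
rewrite -ler_pdivlMl// ltW//; near: y; apply: near_mdist_lt.
by rewrite mulr_gt0// invr_gt0.
Unshelve. all: by end_near. Qed.

Lemma near_mdist_prod (p : M * M) (e : R) : 0 < e ->
  \forall q \near p, mdist p.1 q.1 < e /\ mdist p.2 q.2 < e.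
Proof.
move=> e0; exists ([set y | mdist p.1 y < e], [set y | mdist p.2 y < e]) => //=.
by split; exact: near_mdist_lt.
Qed.

Lemma mdist_continuous : continuous (fun p : M * M => mdist p.1 p.2).
Proof.
move=> [x y]; apply/cvgrPdist_le => e e0.
have e20 : 0 < e / 2 by rewrite divr_gt0.
apply: filterS (near_mdist_prod (x, y) e20) => -[u v] /= [xu yv].
have := metric_triangle x u y; have := metric_triangle u v y.
have := metric_triangle u x v; have := metric_triangle x y v.
rewrite (metric_sym u x) (metric_sym v y) ler_norml => ? ? ? ?.
by apply/andP; split; lra.
Qed.

(** Off the diagonal the slope is a quotient of continuous functions; at the
    diagonal it tends to zero by the little Lipschitz condition. *)
Lemma slope_continuous (f : S_space o) : continuous (slope f).
Proof.
have := valP f; rewrite inE => -[lf _] [x y].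
have [<-|xy] := eqVneq x y.
  apply/cvgrPdist_le => e e0; have [d d0 fd] := lf _ e0.
  have d20 : 0 < d / 2 by rewrite divr_gt0.
  apply: filterS (near_mdist_prod (x, x) d20) => -[u v] /= [xu xv].
  rewrite {1}/slope_fun /= subrr mul0r sub0r normrN.
  have [<-|uv] := eqVneq u v.
    by rewrite /slope_fun /= subrr mul0r normr0 ltW.
  rewrite /slope_fun/= normrM normfV (ger0_norm (mdist_ge0 _ _)).
  rewrite ler_pdivrMr ?mdist_gt0//; apply: fd.
  by have := metric_triangle u x v; rewrite (metric_sym u x); lra.
apply: cvgM.
  apply: cvgB; (apply: continuous_comp; last exact: Lip0_continuous).
    exact: cvg_fst.
  exact: cvg_snd.
apply: cvgV; first by rewrite gt_eqF// mdist_gt0.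
exact: mdist_continuous.
Qed.

Lemma slope_vanishes_at_infinity (f : S_space o) (e : R) :
  proper_metric M -> 0 < e ->
  exists2 K : set (M * M), compact K & forall p, ~ K p -> `|slope f p| <= e.
Proof.
move=> properM e0; have := valP f; rewrite inE => -[_ tf].
have /cvgrPdist_le/(_ _ e0) [r [_ rP]] := tf.
have re : tail_slope (subspace_val f) (r + 1) <= e.
  have := rP (r + 1); rewrite ltrDl ltr01 sub0r normrN => /(_ isT).
  by rewrite ger0_norm ?tail_slope_ge0.
exists (mdist_closed_ball o (r + 1) `*` mdist_closed_ball o (r + 1)).
  by apply: compact_setX; exact: properM.
move=> [x y] /not_andP/= xyK.
have [xy|xy] := eqVneq x y.
  by rewrite /slope_fun xy subrr mul0r normr0 ltW.
rewrite /slope_fun/= normrM normfV (ger0_norm (mdist_ge0 _ _)).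
rewrite ler_pdivrMr ?mdist_gt0//.
rewrite (le_trans (tail_slope_le _ xyK))// ler_wpM2r ?mdist_ge0//.
Qed.

End slopes.

(** * Functionals on S come from the free space *)

Section surjectivity.
Context {R : realType} {M : metricType R} (o : M).
Hypotheses (countableM : countable [set: M]) (properM : proper_metric M).

Local Notation restrS := (dual_restr (@S_pred R M o)).

(** [Phi f] is at most [op_norm Phi * sup0 (slope f)]. An extension dominated by
    [op_norm Phi * sup0] is nonpositive on nonpositive functions, as [sup0] is zero
    there: it is a positive functional on bounded functions on the square of M. *)
Lemma dual_S_positive (Phi : dual (S_space o)) :
  exists2 L : {linear bfun R (M * M) -> R^o},
    (forall u : bfun R (M * M), (forall x, 0 <= u x) -> 0 <= L u) &
    forall f, L (slope f) = Phi f.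
Proof.
pose p (u : bfun R (M * M)) := op_norm Phi * sup0 u.
have pD u v : p (u + v) <= p u + p v.
  by rewrite -mulrDr ler_wpM2l ?op_norm_ge0 ?sup0D.
have pZ (t : R) u : 0 <= t -> p (t *: u) = t * p u.
  by move=> t0; rewrite /p sup0Z// mulrCA.
pose phi : {linear S_space o -> R^o} := dual_val Phi.
have phip f : phi f <= p (slope f).
  rewrite (le_trans (ler_norm _))// (le_trans (op_norm_le Phi f))//.
  by rewrite ler_wpM2l ?op_norm_ge0 ?norm_le_sup0_slope.
have [L Lp Lphi] := hahn_banach pD pZ phip.
exists L => // u u0; rewrite -oppr_le0 -linearN (le_trans (Lp _))//.
rewrite /p mulr_ge0_le0 ?op_norm_ge0//; apply: sup0_le => // x.
by have -> : (- u) x = - u x by []; rewrite oppr_le0.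
Qed.

(** The atom at [(x, y)] of the positive extension of [Phi] contributes the
    multiple of [delta x - delta y] that evaluates slopes at [(x, y)]. *)
Lemma restr_dense (Phi : dual (S_space o)) (e : R) : 0 < e ->
  exists mu : free_space o, `|restrS (\val mu) - Phi| <= e.
Proof.
move=> e0; have [L L0 LPhi] := dual_S_positive Phi.
have hM2 : hausdorff_space (M * M)%type.
  by apply: hausdorff_prod; exact: metric_hausdorff.
have cM2 : countable [set: M * M].
  by rewrite -setXTT; exact: countableX.
have [F FP] := finite_atomic_approx L0 hM2 cM2 e0.
pose m (z : M * M) : dual (Lip0 o) :=
  (atom L z / mdist z.1 z.2) *: (delta o z.1 - delta o z.2).
have dS x : delta o x \in closed_span (range (@delta R M o)).
  by apply: sub_closed_span; exists x.
have mS : \sum_(z <- F) m z \in closed_span (range (@delta R M o)).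
  by apply: rpred_sum => z _; rewrite rpredZ ?rpredB.
exists (NormedSubspace mS); apply: op_norm_lub => [|f]; first exact: ltW.
have E : restrS (\sum_(z <- F) m z) f =
    \sum_(z <- F) slope f z * atom L z.
  transitivity (\sum_(z <- F) m z (subspace_val f)); first exact: dual_sumE.
  apply: eq_bigr => z _.
  transitivity (atom L z / mdist z.1 z.2 *
    (subspace_val f z.1 - subspace_val f z.2)) => //.
  by rewrite [slope f z]/(slope_fun _ z) /slope_fun; ring.
have -> : (restrS (\sum_(z <- F) m z) - Phi) f =
    restrS (\sum_(z <- F) m z) f - Phi f by [].
rewrite E -LPhi distrC; apply: FP => //.
- exact: slope_continuous.
- exact: slope_le.
- by move=> d; exact: slope_vanishes_at_infinity.
Qed.

(** The range of the restriction map is dense, and it is closed because the map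
    is isometric and its domain complete. *)
Lemma restr_surj (Phi : dual (S_space o)) :
  exists mu : free_space o, restrS (\val mu) = Phi.
Proof.
have /choice[mu muP] (e : R) : exists mu : free_space o, 0 < e ->
    `|restrS (\val mu) - Phi| <= e.
  have [e0|e0] := ltP 0 e; last by exists 0.
  by have [nu nuP] := restr_dense Phi e0; exists nu.
have [d e d0 e0|psi psiP] := dual_limit (phi := fun e => \val (mu e)).
  have -> : `|\val (mu d) - \val (mu e)| = `|mu d - mu e| by [].
  rewrite -(restr_norm countableM properM).
  have -> : restrS (\val (mu d - mu e)) =
    (restrS (\val (mu d)) - Phi) - (restrS (\val (mu e)) - Phi).
    by rewrite opprB addrA subrK; exact: val_inj.
  by rewrite (le_trans (ler_normB _ _))// lerD// muP.
have psiS : psi \in closed_span (range (@delta R M o)).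
  by apply: closed_span_limit => e e0; exists (\val (mu e)); [exact: valP|exact: psiP].
exists (NormedSubspace psiS); apply/eqP; rewrite -subr_eq0 -normr_le0.
apply/ler_addgt0Pr => e e0; rewrite add0r.
have e20 : 0 < e / 2 by rewrite divr_gt0.
set nu := restrS (\val (mu (e / 2))).
have psinu : `|restrS psi - nu| <= e / 2.
  have -> : restrS psi - nu =
    restrS (\val (NormedSubspace psiS - mu (e / 2))).
    exact: val_inj.
  by rewrite (restr_norm countableM properM) distrC; exact: psiP.
apply: (le_trans (ler_distD nu _ _)); rewrite [leRHS]splitr.
by apply: lerD => //; exact: muP.
Qed.

Lemma restr_linear :
  linear (fun mu : free_space o => restrS (\val mu)).
Proof. by move=> a mu nu; exact: val_inj. Qed.

End surjectivity.

Theorem theorem2p1 (R : realType) (M : metricType R) (o : M)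
    (countableM : countable [set: M]) (properM : proper_metric M) :
  isometrically_isomorphic (free_space o) (dual (S_space o)).
Proof.
pose T : {linear free_space o -> dual (S_space o)} :=
  HB.pack (fun mu : free_space o => dual_restr (@S_pred R M o) (\val mu))
    (GRing.isLinear.Build _ _ _ _ _ (@restr_linear R M o)).
have Tnorm mu : `|T mu| = `|mu| := restr_norm countableM properM mu.
exists T => //; have /choice[U TU] := restr_surj countableM properM (o := o).
exists U => [mu|Phi]; last exact: TU.
apply/eqP; rewrite -subr_eq0 -normr_eq0 -Tnorm linearB.
have -> : T (U (T mu)) = T mu := TU _.
by rewrite subrr normr0.
Qed.
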